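(* Let $b$ be a complex-valued function on graphs with non-empty vertex set and let $f_b(G,x)=\sum_{k=1}^{|V(G)|}a_k(G)x^k$ with $a_k(G)=\sum_{\{S_1,\dots,S_k\}}b(G[S_1])\cdots b(G[S_k])$ summed over partitions of $V(G)$ into exactly $k$ non-empty sets, and $f_b(\emptyset,x)=1$. Then $f_b$ is 2-multiplicative if and only if (i) $b(H)=0$ for every non-connected graph $H$, and (ii) $b(H_1\cup H_2)=b(H_1)b(H_2)$ whenever $H_1$ and $H_2$ are graphs having exactly one vertex in common.
   Context: All graphs are finite simple graphs; $G[S]$ is the induced subgraph on $S$. A graph polynomial $f$ is multiplicative if $f(G_1\uplus G_2,x)=f(G_1,x)f(G_2,x)$ for disjoint unions, and 2-multiplicative if it is multiplicative and $x f(G_1\cup G_2,x)=f(G_1,x)f(G_2,x)$ whenever $G_1$ and $G_2$ have exactly one vertex in common. *)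

(* Defs.v *)
From HB Require Import structures.
From mathcomp Require Import all_boot all_order all_algebra finmap.


Set Implicit Arguments.
Unset Strict Implicit.
Unset Printing Implicit Defensive.

Import GRing.Theory.
Local Open Scope fset_scope.
Local Open Scope ring_scope.

(* A finite simple graph whose vertices are taken from a universe V. Edges are
   2-element sets of vertices; the condition is boolean, hence two graphs are
   equal as soon as their vertex sets and edge sets are. *)
Record sgraph (V : choiceType) := SGraph {
  vert : {fset V};
  edges : {fset {fset V}};
  edgesP : all (fun e : {fset V} => (e `<=` vert) && (#|` e| == 2)) edges
}.

Section Graphs.
Variable V : choiceType.
Implicit Types (G H : sgraph V) (S : {fset V}).

Lemma gunion_subproof G1 G2 :
  all (fun e : {fset V} => (e `<=` vert G1 `|` vert G2) && (#|` e| == 2))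
      (edges G1 `|` edges G2).
Proof.
apply/allP => e; rewrite in_fsetU => /orP[] he.
- have /andP[sub ->] := allP (edgesP G1) e he.
  by rewrite andbT (fsubset_trans sub) // fsubsetUl.
- have /andP[sub ->] := allP (edgesP G2) e he.
  by rewrite andbT (fsubset_trans sub) // fsubsetUr.
Qed.

Definition gunion G1 G2 : sgraph V := SGraph (gunion_subproof G1 G2).

Lemma induced_subproof G S :
  all (fun e : {fset V} => (e `<=` vert G `&` S) && (#|` e| == 2))
      [fset e in edges G | e `<=` S].
Proof.
apply/allP => e; rewrite !inE /= => /andP[he eS].
have /andP[sub ->] := allP (edgesP G) e he.
by rewrite andbT fsubsetI sub eS.
Qed.

(* G[S], meant for S `<=` vert G. *)
Definition induced G S : sgraph V := SGraph (induced_subproof G S).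

Definition adj G : rel V := fun u v => [fset u; v] \in edges G.

Definition gconnected G : Prop :=
  forall u v, u \in vert G -> v \in vert G ->
    exists2 p : seq V, path (adj G) u p & last u p = v.

(* Same shape as finset.partition. *)
Definition fpartition (P : {fset {fset V}}) S : bool :=
  [&& fcover P == S, trivIfset P & fset0 \notin P].

End Graphs.

Section GraphPolynomials.
Variables (V : choiceType) (C : comNzRingType).

Definition multiplicative_gpoly (f : sgraph V -> {poly C}) : Prop :=
  forall G1 G2 : sgraph V, [disjoint vert G1 & vert G2] ->
    f (gunion G1 G2) = f G1 * f G2.

Definition two_multiplicative (f : sgraph V -> {poly C}) : Prop :=
  multiplicative_gpoly f /\
  forall G1 G2 : sgraph V, #|` vert G1 `&` vert G2| = 1%N ->
    'X * f (gunion G1 G2) = f G1 * f G2.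

(* The value of b at the graph without vertices is never used below, so a total
   b stands for a function on graphs with non-empty vertex set. *)
Variable b : sgraph V -> C.

Definition acoef (G : sgraph V) (k : nat) : C :=
  \sum_(P <- fpowerset (fpowerset (vert G)) | fpartition P (vert G) && (#|` P| == k))
    \prod_(S <- P) b (induced G S).

Definition fpoly (G : sgraph V) : {poly C} :=
  if vert G == fset0 then 1
  else \sum_(1 <= k < (#|` vert G|).+1) acoef G k *: 'X^k.

End GraphPolynomials.

(* Main.v *)
(** Give a block S of V(G) the weight b(G[S]) x; then f_b(G) is the sum over all
    partitions of V(G) of the product of the block weights.  Splitting off the
    block that contains a chosen vertex gives a recursion in terms of subsets
    only.  If blocks meeting both sides of a disjoint union have weight 0, the
    recursion yields multiplicativity by induction; for a common vertex v it is
    applied at v, where condition (ii) factors the weight of the block of v and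
    the remaining vertices form a disjoint union.  Conversely, f_b(G) has no
    constant term and linear coefficient b(G), so (i) and (ii) are read off from
    the coefficients of x and x^2. *)

Require Import Defs.
From mathcomp Require Import all_boot all_order all_algebra finmap.
From mathcomp Require Import boolp reals complex.

Set Implicit Arguments.
Unset Strict Implicit.
Unset Printing Implicit Defensive.

Import GRing.Theory.
Local Open Scope fset_scope.
Local Open Scope ring_scope.

(** All reindexings below go through this form: the index types may differ, and [h] and [h'] need to
    be mutually inverse only on the selected entries. Uniqueness of both lists turns the bijection
    into a permutation. *)
Lemma big_seq_bij (R : Type) (idx : R) (op : Monoid.com_law idx)
    (I J : eqType) (s : seq I) (t : seq J) (P : pred I) (Q : pred J)
    (F : I -> R) (G : J -> R) (h : I -> J) (h' : J -> I) :
  uniq s -> uniq t ->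
  (forall i, i \in s -> P i -> [/\ h i \in t, Q (h i) & h' (h i) = i]) ->
  (forall j, j \in t -> Q j ->
     [/\ h' j \in s, P (h' j), h (h' j) = j & F (h' j) = G j]) ->
  \big[op/idx]_(i <- s | P i) F i = \big[op/idx]_(j <- t | Q j) G j.
Proof.
move=> us ut hP h'P; rewrite -big_filter -[RHS]big_filter.
have st : perm_eq [seq i <- s | P i] [seq h' j | j <- t & Q j].
  apply: uniq_perm; first exact: filter_uniq.
    rewrite map_inj_in_uniq ?filter_uniq // => j k.
    rewrite !mem_filter => /andP[Qj tj] /andP[Qk tk] e.
    by have [_ _ <- _] := h'P j tj Qj; have [_ _ <- _] := h'P k tk Qk; rewrite e.
  move=> i; rewrite mem_filter; apply/andP/mapP => [[Pi si]|[j]].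
    have [th Qh e] := hP i si Pi.
    by exists (h i); rewrite ?mem_filter ?Qh.
  by rewrite mem_filter => /andP[Qj tj] ->; have [] := h'P j tj Qj.
rewrite (perm_big _ st) big_map; apply: eq_big_seq => j; rewrite mem_filter => /andP[Qj tj].
by have [] := h'P j tj Qj.
Qed.

(** * Partitions of a finite set *)

Section SetPartitions.
Variable V : choiceType.
Implicit Types (A B S T : {fset V}) (P : {fset {fset V}}).

Lemma fcoverP P x : reflect (exists2 B, B \in P & x \in B) (x \in fcover P).
Proof.
apply: (iffP idP) => [/bigfcupP[B]|[B BP xB]].
  by rewrite andbT => BP xB; exists B.
by apply/bigfcupP; exists B; rewrite ?BP.
Qed.

Lemma fpartitionP P S :
  reflect [/\ forall x, x \in S <-> exists2 B, B \in P & x \in B,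
              forall A B x, A \in P -> B \in P -> x \in A -> x \in B -> A = B
            & fset0 \notin P]
          (fpartition P S).
Proof.
apply: (iffP and3P) => [[/eqP <- /trivIfsetP tP P0]|[cP tP P0]]; split=> //.
- by move=> x; split=> /fcoverP.
- move=> A B x AP BP xA xB; apply/eqP/negPn/negP => AB.
  by have /fdisjointP/(_ x xA) := tP A B AP BP AB; rewrite xB.
- by apply/eqP/fsetP => x; apply/fcoverP/idP => /cP.
- apply/trivIfsetP => A B AP BP /eqP AB; apply/fdisjointP => x xA.
  by apply/negP => xB; apply: AB; apply: tP xA xB.
Qed.

Lemma fpartition_powerset P S : fpartition P S -> P \in fpowerset (fpowerset S).
Proof.
case/fpartitionP => cP _ _; rewrite fpowersetE; apply/fsubsetP => B BP.
by rewrite fpowersetE; apply/fsubsetP => x xB; apply/cP; exists B.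
Qed.

Lemma fpartition_set0 P : fpartition P fset0 = (P == fset0).
Proof.
apply/fpartitionP/eqP => [[cP _ P0]|->].
  apply/eqP; apply: contraR P0 => /fset0Pn[B BP].
  suff <- : B = fset0 by [].
  apply/eqP; apply/negPn/negP => /fset0Pn[x xB].
  suff: x \in fset0 by [].
  by apply/cP; exists B.
by split=> // x; split=> // -[].
Qed.

Lemma fpartition_set1 P S :
  S != fset0 -> fpartition P S && (#|` P| == 1%N) = (P == [fset S]).
Proof.
move=> S0; apply/andP/eqP => [[/and3P[/eqP <- _ _] /cardfs1P[B ->]]|->].
  by rewrite /fcover big_seq_fset1.
split; last by rewrite cardfs1.
apply/and3P; split; first by rewrite /fcover big_seq_fset1.
  by rewrite /trivIfset /fcover !big_seq_fset1.
by rewrite inE eq_sym.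
Qed.

(** The block sizes add up to the size of [S], and each is at least 1. Hence cutting off the sum in
    [fpoly] at the number of vertices loses no partition. *)
Lemma card_fpartition P S : fpartition P S -> (#|` P| <= #|` S|)%N.
Proof.
case/and3P => /eqP <- /eqP <- P0.
rewrite -sum1_size big_seq [X in (_ <= X)%N]big_seq; apply: leq_sum => B BP.
by rewrite cardfs_gt0; apply: contraNneq P0 => <-.
Qed.

(** The block at [v] is computed by a search, so that it can serve as a function in a reindexing;
    the default [fset0] appears only if [P] does not cover [v]. *)
Definition fblock P (v : V) : {fset V} :=
  nth fset0 P (find (fun B : {fset V} => v \in B) P).

Lemma fblockP P S v : fpartition P S -> v \in S ->
  [/\ fblock P v \in P, v \in fblock P v
    & forall B, B \in P -> v \in B -> B = fblock P v].
Proof.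
case/fpartitionP => cP tP _ /cP[B BP vB].
have hv : has (fun B : {fset V} => v \in B) P by apply/hasP; exists B.
have fP : fblock P v \in P by rewrite mem_nth // -has_find.
have vf : v \in fblock P v by apply: (nth_find fset0 hv).
by split=> // C CP vC; apply: tP CP fP vC vf.
Qed.

Lemma fpartitionD1 P S T :
  T \in P -> fpartition P S -> fpartition (P `\ T) (S `\` T).
Proof.
move=> TP /fpartitionP[cP tP P0]; apply/fpartitionP; split.
- move=> x; rewrite inE; split=> [/andP[xT /cP[B BP xB]]|[B]].
    by exists B; rewrite // !inE BP andbT; apply: contraNneq xT => <-.
  rewrite !inE => /andP[/eqP BT BP] xB; apply/andP; split.
    by apply/negP => xT; apply: BT; apply: tP xB xT.
  by apply/cP; exists B.
- by move=> A B x; rewrite !inE => /andP[_ AP] /andP[_ BP]; apply: tP.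
- by rewrite !inE negb_and P0 orbT.
Qed.

Lemma fpartitionU1 P S T : T != fset0 -> T `<=` S ->
  fpartition P (S `\` T) -> T \notin P /\ fpartition (T |` P) S.
Proof.
move=> T0 /fsubsetP TS /fpartitionP[cP tP P0].
have dT B x : B \in P -> x \in B -> x \notin T.
  move=> BP xB; suff: x \in S `\` T by rewrite inE => /andP[].
  by apply/cP; exists B.
split.
  by apply/negP => TP; case/fset0Pn: T0 => x xT; have:= dT T x TP xT; rewrite xT.
apply/fpartitionP; split.
- move=> x; split=> [xS|[B]].
    have [xT|xT] := boolP (x \in T); first by exists T; rewrite // fset1U1.
    have [|B BP xB] := (cP x).1; first by rewrite inE xT.
    by exists B => //; rewrite fset1Ur.
  case/fset1UP => [->|BP] xB; first exact: TS.
  suff: x \in S `\` T by rewrite inE => /andP[].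
  by apply/cP; exists B.
- move=> A B x /fset1UP[->|AP] /fset1UP[->|BP] // xA xB.
  + by have := dT B x BP xB; rewrite xA.
  + by have := dT A x AP xA; rewrite xB.
  + exact: tP xA xB.
- by rewrite !inE negb_or P0 eq_sym T0.
Qed.

End SetPartitions.

(** * Sums over partitions with multiplicative block weights *)

Section PartitionSums.
Variables (V : choiceType) (C : comNzRingType).
Implicit Types (A B S T : {fset V}) (P : {fset {fset V}}) (w : {fset V} -> C).

(** As a function of [S], this is the exponential of [w], restricted to non-empty sets, with respect
    to subset convolution. *)
Definition partsum w S : C :=
  \sum_(P <- fpowerset (fpowerset S) | fpartition P S) \prod_(B <- P) w B.

Lemma eq_partsum w w' S :
  (forall T, T `<=` S -> w T = w' T) -> partsum w S = partsum w' S.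
Proof.
move=> ww'; apply: eq_bigr => P /fpartition_powerset.
rewrite fpowersetE => /fsubsetP sP; apply: eq_big_seq => B /sP.
by rewrite fpowersetE => /ww'.
Qed.

Lemma partsum0 w : partsum w fset0 = 1.
Proof.
rewrite /partsum (eq_bigl _ _ (@fpartition_set0 V)) -big_filter.
rewrite (_ : [seq P <- _ | _] = [:: fset0]) ?big_seq1 ?big_seq_fset0 //.
rewrite filter_pred1_uniq ?fset_uniq // fpowersetE; exact: fsub0set.
Qed.

(** A partition [P] corresponds to the pair of its block [T] at [v] and the partition of the
    complement of [T] formed by the other blocks; adding [T] back is the inverse map. *)
Lemma partsum_block w S v : v \in S ->
  partsum w S = \sum_(T <- fpowerset S | v \in T) w T * partsum w (S `\` T).
Proof.
move=> vS; under [RHS]eq_bigr do rewrite mulr_sumr.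
rewrite pair_big_dep_cond.
apply: (@big_seq_bij _ _ _ _ _ _ _ _ _ _ _
  (fun P => (fblock P v, P `\ fblock P v)) (fun p => p.1 |` p.2));
  rewrite ?fset_uniq //.
- move=> P _ pP; have [bP vb _] := fblockP pP vS.
  split=> //=; last by rewrite fsetD1K.
  apply/imfset2P; exists (fblock P v) => /=.
    rewrite !inE vb andbT.
    by have:= fpartition_powerset pP; rewrite fpowersetE => /fsubsetP; apply.
  exists (P `\ fblock P v) => //; have pD := fpartitionD1 bP pP.
  by rewrite !inE pD (fpartition_powerset pD).
- move=> j /imfset2P[T /=]; rewrite !inE => /andP[TS vT] [P].
  rewrite !inE => /andP[_ pP] -> {j} _ /=; move: TS; rewrite fpowersetE => TS.
  have T0 : T != fset0 by apply/fset0Pn; exists v.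
  have [TP pU] := fpartitionU1 T0 TS pP.
  have [_ _ /(_ T (fset1U1 _ _) vT) <-] := fblockP pU vS.
  by rewrite (fpartition_powerset pU) big_fsetU1 // fsetU1K.
Qed.

(** Deleting [v] from its block makes the index range over a full power set, which splits as a
    product when [A] is a disjoint union. *)
Lemma partsumU1 w A v : v \notin A ->
  partsum w (v |` A) =
    \sum_(T <- fpowerset A) w (v |` T) * partsum w (A `\` T).
Proof.
move=> vA; rewrite (@partsum_block _ _ v) ?fset1U1 //.
apply: (@big_seq_bij _ _ _ _ _ _ _ _ _ _ _
  (fun T => T `\ v) (fun T => v |` T)); rewrite ?fset_uniq //.
- move=> T; rewrite !fpowersetE => TA vT; rewrite fsetD1K //; split=> //.
  by rewrite fsubDset.
- move=> T; rewrite !fpowersetE => TA _; rewrite fset1U1 fsetUS //; split=> //.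
    by rewrite fsetU1K //; apply: contraNN vA; apply: (fsubsetP TA).
  congr (_ * partsum _ _); apply/fsetP => x; rewrite !inE.
  by case: eqP => //= ->; rewrite (negPf vA) andbF.
Qed.

Lemma big_fpowersetU A B (F : {fset V} -> C) : [disjoint A & B] ->
  \sum_(T <- fpowerset (A `|` B)) F T =
    \sum_(T1 <- fpowerset A) \sum_(T2 <- fpowerset B) F (T1 `|` T2).
Proof.
move=> dAB; rewrite pair_big_dep_cond.
have hA x : x \in A -> (x \in B) = false.
  by move/(fdisjointP dAB)/negPf.
apply: (@big_seq_bij _ _ _ _ _ _ _ _ _ _ _
  (fun T => (T `&` A, T `&` B)) (fun p => p.1 `|` p.2)); rewrite ?fset_uniq //.
- move=> T; rewrite fpowersetE => TAB _; split=> //=.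
    apply/imfset2P; exists (T `&` A); first by rewrite !inE fpowersetE fsubsetIr.
    by exists (T `&` B) => //; rewrite !inE fpowersetE fsubsetIr.
  by rewrite -fsetIUr; apply/fsetIidPl.
- move=> j /imfset2P[T1 /=]; rewrite !inE fpowersetE andbT => /fsubsetP T1A [T2].
  rewrite !inE fpowersetE andbT => /fsubsetP T2B -> {j} _ /=; split=> //.
    rewrite fpowersetE; apply/fsubsetP => x; rewrite !inE.
    by case/orP => [/T1A|/T2B] ->; rewrite ?orbT.
  congr (_, _); apply/fsetP => x; rewrite !inE.
    have [/T1A -> //|_] := boolP (x \in T1).
    have [/T2B xB|//] := boolP (x \in T2).
    by apply/negP => /hA; rewrite xB.
  have [/T2B ->|_] := boolP (x \in T2); first by rewrite orbT.
  by have [/T1A/hA|//] := boolP (x \in T1).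
Qed.

(** Induction on the size of [A], expanding at some [v] in [A]: the block [T] of [v] may be taken
    inside [A], and removing it leaves the smaller set [A] minus [T] beside an unchanged [B]. *)
Lemma partsumU w A B : [disjoint A & B] ->
  (forall T x y, T `<=` A `|` B -> x \in T -> x \in A -> y \in T -> y \in B ->
     w T = 0) ->
  partsum w (A `|` B) = partsum w A * partsum w B.
Proof.
have [n] := ubnP #|` A|; elim: n A => // n IH A /ltnSE leAn dAB w0.
have [->|/fset0Pn[v vA]] := eqVneq A fset0.
  by rewrite fset0U partsum0 mul1r.
rewrite (@partsum_block w A v) // (@partsum_block _ _ v) ?inE ?vA //.
(* A block at [v] that is not contained in [A] has an element in [B], so its weight is 0. *)
rewrite big_distrl (bigID (fun T => T `<=` A)) /= [X in _ + X]big_seq_cond.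
rewrite [X in _ + X]big1 ?addr0; last first.
  move=> T; rewrite fpowersetE => /and3P[TAB vT /fsubsetPn[y yT yA]].
  rewrite (w0 T v y) ?mul0r //.
  by have := fsubsetP TAB y yT; rewrite !inE (negPf yA).
(* Both sums run over the same blocks, seen once as subsets of the union that lie in [A] and once as
   subsets of [A]. *)
apply: (@big_seq_bij _ _ _ _ _ _ _ _ _ _ _ id id); rewrite ?fset_uniq //.
  by move=> T; rewrite !fpowersetE => _ /andP[].
move=> T; rewrite !fpowersetE => TA vT; split=> //.
- by rewrite (fsubset_trans TA) ?fsubsetUl.
- by rewrite vT.
rewrite -mulrA -IH.
- congr (_ * partsum _ _); apply/fsetP => x; rewrite !inE.
  have [xT|//] := boolP (x \in T); rewrite /=.
  by apply/esym/negbTE/(fdisjointP dAB)/(fsubsetP TA).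
- apply: leq_trans leAn; apply: fproper_ltn_card.
  rewrite fproperE fsubsetDl; apply/fsubsetPn.
  by exists v; rewrite // inE vT.
- by apply: fdisjointWl dAB; apply: fsubsetDl.
- move=> U x y UAB xU xA yU yB; apply: (w0 U x y) => //.
    by apply: fsubset_trans UAB _; apply: fsetSU; apply: fsubsetDl.
  by move: xA; rewrite inE => /andP[].
Qed.

(** Expanding at [v] on both sides, the block of [v] on the left is cut into its traces on [A] and
    [B], and the rest factors by [partsumU]. The scalar [c] will be ['X]: it makes up for one block
    at [v] on the left against two on the right. *)
Lemma partsum_glue w A B v c :
  [disjoint A & B] -> v \notin A -> v \notin B ->
  (forall T x y, T `<=` A `|` B -> x \in T -> x \in A -> y \in T -> y \in B ->
     w T = 0) ->
  (forall T1 T2, T1 `<=` A -> T2 `<=` B ->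
     c * w (v |` (T1 `|` T2)) = w (v |` T1) * w (v |` T2)) ->
  c * partsum w (v |` (A `|` B)) = partsum w (v |` A) * partsum w (v |` B).
Proof.
move=> dAB vA vB w0 wM.
rewrite !partsumU1 ?inE ?negb_or ?vA // big_fpowersetU // big_distrlr /= mulr_sumr.
rewrite big_seq [RHS]big_seq; apply: eq_bigr => T1; rewrite fpowersetE => T1A.
rewrite mulr_sumr big_seq [RHS]big_seq; apply: eq_bigr => T2.
rewrite fpowersetE => T2B.
(* Since [T1] lies in [A] and [T2] in [B], the complement of the block is again a disjoint union
   with one part on each side. *)
have -> : (A `|` B) `\` (T1 `|` T2) = (A `\` T1) `|` (B `\` T2).
  apply/fsetP => x; rewrite !inE.
  have [xA|xA] := boolP (x \in A).
    have xB := fdisjointP dAB x xA.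
    have xT2 : x \notin T2 by apply: contraNN xB; apply: (fsubsetP T2B).
    by rewrite (negPf xB) (negPf xT2) /= !orbF.
  have xT1 : x \notin T1 by apply: contraNN xA; apply: (fsubsetP T1A).
  by rewrite (negPf xT1).
rewrite partsumU.
- by rewrite mulrA wM // mulrACA.
- by apply: fdisjointWl (fsubsetDl _ _) _; apply: fdisjointWr (fsubsetDl _ _) _.
move=> T x y TAB xT xA yT yB; apply: (w0 T x y) => //.
- by apply: fsubset_trans TAB _; apply: fsetUSS; apply: fsubsetDl.
- by move: xA; rewrite inE => /andP[].
- by move: yB; rewrite inE => /andP[].
Qed.

End PartitionSums.

(** * Connectivity, unions and induced subgraphs *)

Section Graphs.
Variable V : choiceType.
Implicit Types (G H : sgraph V) (S T : {fset V}).

Lemma sgraph_eq G H : vert G = vert H -> edges G = edges H -> G = H.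
Proof.
by case: G H => v e p [v' e' p'] /= ev ee; subst; congr SGraph; apply: bool_irrelevance.
Qed.

Lemma edge_sub G e : e \in edges G -> e `<=` vert G.
Proof. by move/(allP (edgesP G))/andP => []. Qed.

Lemma card_edge G e : e \in edges G -> #|` e| = 2.
Proof. by move/(allP (edgesP G))/andP => [_ /eqP]. Qed.

Lemma edgeE G e x y : e \in edges G -> x \in e -> y \in e -> x != y ->
  e = [fset x; y].
Proof.
move=> /card_edge e2 xe ye xy; apply/esym/eqP.
by rewrite eqEfcard fsubUset !fsub1set xe ye cardfs2 xy e2.
Qed.

Lemma induced_vert G : induced G (vert G) = G.
Proof.
apply: sgraph_eq; rewrite /= ?fsetIid //; apply/fsetP => e; rewrite !inE /=.
by have [/edge_sub|//] := boolP (e \in edges G).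
Qed.

(** No edge leaves [A], so by induction along the path a walk from [x] stays in [A] and never
    reaches [y]. *)
Lemma not_gconnected_cut G A x y : x \in vert G -> y \in vert G ->
  x \in A -> y \notin A ->
  (forall e z, e \in edges G -> z \in e -> z \in A -> e `<=` A) ->
  ~ gconnected G.
Proof.
move=> xG yG xA yA cut /(_ x y xG yG)[p]; elim: p x {xG} xA => /= [|z p IH] x xA.
  by move=> _ xy; rewrite -xy xA in yA.
case/andP => xz; apply: IH.
by apply: (fsubsetP (cut _ x xz _ xA)); rewrite ?fset21 ?fset22.
Qed.

Lemma not_gconnected_split H : ~ gconnected H ->
  exists G1 G2 : sgraph V, [/\ vert G1 != fset0, vert G2 != fset0,
    [disjoint vert G1 & vert G2] & H = gunion G1 G2].
Proof.
move=> /existsNP[u] /existsNP[v] /not_implyP[uH] /not_implyP[vH nuv].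
pose r x := exists2 p : seq V, path (adj H) u p & last u p = x.
(* [A] is the connected component of [u]; reachability is a proposition, made boolean classically.
   The two graphs are induced on [A] and on its complement. *)
pose A := [fset x in vert H | `[< r x >]].
have uA : u \in A by rewrite !inE uH; apply/asboolP; exists [::].
have vA : v \notin A by rewrite !inE vH /=; apply/asboolP.
have AH : A `<=` vert H by apply/fsubsetP => x; rewrite !inE => /andP[].
(* A walk from [u] to one end of an edge extends to the other end. *)
have cut e x : e \in edges H -> x \in e -> x \in A -> e `<=` A.
  move=> eH xe; rewrite !inE => /andP[_ /asboolP[p pp lp]].
  apply/fsubsetP => y ye; have [<-|xy] := eqVneq x y.
    by rewrite !inE (fsubsetP (edge_sub eH)) //=; apply/asboolP; exists p.
  rewrite !inE (fsubsetP (edge_sub eH)) //=; apply/asboolP; exists (rcons p y).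
    by rewrite rcons_path pp lp /adj -(edgeE eH xe ye xy).
  by rewrite last_rcons.
exists (induced H A), (induced H (vert H `\` A)); split=> /=.
- by apply/fset0Pn; exists u; rewrite inE uH.
- by apply/fset0Pn; exists v; rewrite 2!inE vH vA.
- by apply/fdisjointP => x; rewrite 3!inE => /andP[_ ->]; rewrite /= andbF.
apply: sgraph_eq => /=.
  by apply/fsetP => x; rewrite 4!inE; case: (x \in vert H); case: (x \in A).
apply/fsetP => e; rewrite !inE /=; have [eH|//] := boolP (e \in edges H).
have [//|/fsubsetPn[x xe xA]] := boolP (e `<=` A); apply/esym/fsubsetP => y ye.
rewrite inE (fsubsetP (edge_sub eH)) // andbT.
by apply/negP => yA; rewrite (fsubsetP (cut e y eH ye yA)) in xA.
Qed.

Lemma gunionC G1 G2 : gunion G1 G2 = gunion G2 G1.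
Proof. by apply: sgraph_eq; rewrite /= fsetUC. Qed.

(** An edge of [G2] inside [S] would put two vertices into the intersection. The bound 1 covers both
    disjoint unions and gluing at a vertex. *)
Lemma induced_gunionl G1 G2 S : (#|` vert G1 `&` vert G2| <= 1)%N ->
  S `<=` vert G1 -> induced (gunion G1 G2) S = induced G1 S.
Proof.
move=> c1 SG; apply: sgraph_eq => /=.
  by apply/fsetP => x; rewrite !inE; have [/(fsubsetP SG) ->|] := boolP (x \in S);
     rewrite ?andbF.
apply/fsetP => e; rewrite !inE /=; have [eS|] := boolP (e `<=` S); rewrite ?andbF //.
rewrite !andbT; have [//|_ /=] := boolP (e \in edges G1).
apply/negP => eG; suff: (#|` e| <= 1)%N by rewrite (card_edge eG).
apply: leq_trans c1; apply: fsubset_leq_card.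
by rewrite fsubsetI (edge_sub eG) (fsubset_trans eS).
Qed.

Lemma induced_gunionr G1 G2 S : (#|` vert G1 `&` vert G2| <= 1)%N ->
  S `<=` vert G2 -> induced (gunion G1 G2) S = induced G2 S.
Proof. by rewrite gunionC fsetIC; apply: induced_gunionl. Qed.

Lemma induced_gunion G1 G2 S : induced (gunion G1 G2) S =
  gunion (induced G1 (S `&` vert G1)) (induced G2 (S `&` vert G2)).
Proof.
apply: sgraph_eq => /=.
  by apply/fsetP => x; rewrite !inE; case: (x \in S); rewrite ?andbF ?andbT ?andbb.
apply/fsetP => e; rewrite !inE /= !fsubsetI.
have [/edge_sub -> /=|_ /=] := boolP (e \in edges G1);
have [/edge_sub -> /=|_ /=] := boolP (e \in edges G2);
by rewrite ?andbT ?orbF ?orbb.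
Qed.

(** As [S] avoids the common vertices, an edge inside [S] that meets [vert G1] cannot come from
    [G2], so [vert G1] is a cut. *)
Lemma induced_gunion_not_connected G1 G2 S x y :
  S `<=` vert G1 `|` vert G2 -> [disjoint S & vert G1 `&` vert G2] ->
  x \in S -> x \in vert G1 -> y \in S -> y \in vert G2 ->
  ~ gconnected (induced (gunion G1 G2) S).
Proof.
move=> SG dS xS x1 yS y2.
have y1 : y \notin vert G1.
  by have := fdisjointP dS y yS; rewrite inE y2 andbT.
apply: (@not_gconnected_cut _ (vert G1) x y); rewrite ?inE ?x1 ?xS ?y2 ?orbT //.
move=> e z; rewrite !inE /= => /andP[/orP[/edge_sub//|/edge_sub/fsubsetP e2]].
move=> /fsubsetP eS ze z1; have := fdisjointP dS z (eS z ze).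
by rewrite inE z1 e2.
Qed.

End Graphs.

(** * The polynomial as a partition sum, and its lowest coefficients *)

Section GraphPolynomials.
Variables (V : choiceType) (C : comNzRingType) (b : sgraph V -> C).
Implicit Types (G H : sgraph V) (S T : {fset V}).

Definition block_weight G S : {poly C} := b (induced G S) *: 'X.

Lemma fpoly_partsum G : fpoly b G = partsum (block_weight G) (vert G).
Proof.
rewrite /fpoly; have [->|G0] := eqVneq; first by rewrite partsum0.
have prodw P : \prod_(S <- P) block_weight G S =
    (\prod_(S <- P) b (induced G S)) *: 'X^(size P).
  elim: P => [|S P IH]; first by rewrite !big_nil scale1r.
  by rewrite !big_cons IH /block_weight -scalerAl -scalerAr scalerA exprS.
(* The condition on the number of blocks moves into the summand, so that the sums over [k] and over
   partitions can be exchanged. *)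
under eq_bigr do rewrite scaler_suml big_mkcondr /=.
rewrite exchange_big /=; apply: eq_bigr => P pP.
rewrite prodw.
have P0 : (0 < #|` P|)%N.
  rewrite cardfs_gt0; apply: contraNneq G0 => P0.
  by case/and3P: pP => /eqP <- _ _; rewrite P0 /fcover big_seq_fset0.
(* Each [P] contributes to exactly one [k], its number of blocks, which lies in the range from 1 to
   the number of vertices. *)
rewrite (bigD1_seq #|` P|) ?iota_uniq //=; last first.
  by rewrite mem_index_iota P0 ltnS card_fpartition.
rewrite eqxx [X in _ + X]big1 ?addr0 // => k kP.
by rewrite eq_sym (negPf kP) ?scale0r.
Qed.

Lemma coef_fpoly0 G : vert G != fset0 -> (fpoly b G)`_0 = 0.
Proof.
move=> /negPf G0; rewrite /fpoly G0 coef_sum big_nat big1 // => k /andP[k0 _].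
by rewrite coefZ coefXn eq_sym gtn_eqF // mulr0.
Qed.

Lemma acoef1 G : vert G != fset0 -> acoef b G 1 = b G.
Proof.
move=> G0; rewrite /acoef (eq_bigl _ _ (fun P => fpartition_set1 P G0)) -big_filter.
rewrite filter_pred1_uniq ?fset_uniq //.
  by rewrite big_seq1 big_seq_fset1 induced_vert.
by rewrite fpowersetE fsub1set fpowersetE fsubset_refl.
Qed.

Lemma coef_fpoly1 G : vert G != fset0 -> (fpoly b G)`_1 = b G.
Proof.
move=> G0; rewrite /fpoly (negPf G0) coef_sum big_ltn ?ltnS ?cardfs_gt0 //.
rewrite coefZ coefXn eqxx mulr1 acoef1 // big_nat big1 ?addr0 // => k /andP[k1 _].
by rewrite coefZ coefXn ltn_eqF // mulr0.
Qed.

(** * Necessity of the two conditions *)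

Lemma multiplicative_disconnected H : multiplicative_gpoly (fpoly b) ->
  vert H != fset0 -> ~ gconnected H -> b H = 0.
Proof.
move=> fM H0 /not_gconnected_split[G1 [G2 [G10 G20 dG eH]]].
(* Every term in the linear coefficient of the product contains a constant coefficient of one
   factor, which is 0 because both parts are non-empty. *)
rewrite -coef_fpoly1 // eH fM // coefM !big_ord_recl big_ord0 /=.
by rewrite !coef_fpoly0 // mul0r mulr0 !addr0.
Qed.

Lemma two_multiplicative_gunion G1 G2 : two_multiplicative (fpoly b) ->
  #|` vert G1 `&` vert G2| = 1%N -> b (gunion G1 G2) = b G1 * b G2.
Proof.
move=> [_ fM] c1.
have /fset0Pn[v] : vert G1 `&` vert G2 != fset0 by rewrite -cardfs_gt0 c1.
rewrite inE => /andP[v1 v2].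
have G10 : vert G1 != fset0 by apply/fset0Pn; exists v.
have G20 : vert G2 != fset0 by apply/fset0Pn; exists v.
have G0 : vert (gunion G1 G2) != fset0 by apply/fset0Pn; exists v; rewrite inE v1.
(* The factor ['X] shifts the linear coefficient of the union to degree 2; on the right, only the
   product of the linear coefficients survives there. *)
have := congr1 (fun p : {poly C} => p`_2) (fM G1 G2 c1).
rewrite coefXM /= coef_fpoly1 // => ->.
rewrite coefM !big_ord_recl big_ord0 /= /bump /= !coef_fpoly0 // !coef_fpoly1 //.
by rewrite mul0r mulr0 !addr0 add0r.
Qed.

(** * Sufficiency of the two conditions *)

Hypothesis b_disconnected :
  forall H, vert H <> fset0 -> ~ gconnected H -> b H = 0.

Lemma block_weight_cross G1 G2 T x y :
  T `<=` vert G1 `|` vert G2 -> [disjoint T & vert G1 `&` vert G2] ->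
  x \in T -> x \in vert G1 -> y \in T -> y \in vert G2 ->
  block_weight (gunion G1 G2) T = 0.
Proof.
move=> TG dT xT x1 yT y2; rewrite /block_weight b_disconnected ?scale0r //.
  by move/fsetP/(_ x); rewrite !inE x1 xT.
exact: (induced_gunion_not_connected TG dT xT x1 yT y2).
Qed.

(** This allows a single weight function, that of the union, for all three polynomials, as
    [partsumU] and [partsum_glue] require. *)
Lemma partsum_gunionl G1 G2 : (#|` vert G1 `&` vert G2| <= 1)%N ->
  partsum (block_weight (gunion G1 G2)) (vert G1) = fpoly b G1.
Proof.
move=> c1; rewrite fpoly_partsum; apply: eq_partsum => T TG.
by rewrite /block_weight induced_gunionl.
Qed.

Lemma partsum_gunionr G1 G2 : (#|` vert G1 `&` vert G2| <= 1)%N ->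
  partsum (block_weight (gunion G1 G2)) (vert G2) = fpoly b G2.
Proof. by rewrite gunionC fsetIC; apply: partsum_gunionl. Qed.

Lemma fpoly_multiplicative : multiplicative_gpoly (fpoly b).
Proof.
move=> G1 G2 dG; have I0 : vert G1 `&` vert G2 = fset0 by apply/eqP.
have c1 : (#|` vert G1 `&` vert G2| <= 1)%N by rewrite I0 cardfs0.
rewrite fpoly_partsum /= partsumU //.
  by rewrite partsum_gunionl // partsum_gunionr.
move=> T x y TG xT x1 yT y2; apply: (block_weight_cross TG _ xT x1 yT y2).
by rewrite I0 fdisjointX0.
Qed.

Hypothesis b_glue : forall H1 H2, #|` vert H1 `&` vert H2| = 1%N ->
  b (gunion H1 H2) = b H1 * b H2.

Lemma fpoly_glue G1 G2 : #|` vert G1 `&` vert G2| = 1%N ->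
  'X * fpoly b (gunion G1 G2) = fpoly b G1 * fpoly b G2.
Proof.
move=> c1; have c1' : (#|` vert G1 `&` vert G2| <= 1)%N by rewrite c1.
have /cardfs1P[v Iv] : #|` vert G1 `&` vert G2| == 1%N by rewrite c1.
have : v \in vert G1 `&` vert G2 by rewrite Iv inE.
rewrite inE => /andP[v1 v2].
have inI x : x \in vert G1 -> x \in vert G2 -> x = v.
  by move=> x1 x2; apply/fset1P; rewrite -Iv inE x1.
rewrite -(partsum_gunionl c1') -(partsum_gunionr c1') fpoly_partsum /=.
pose A := vert G1 `\ v; pose B := vert G2 `\ v.
have eA : vert G1 = v |` A by rewrite fsetD1K.
have eB : vert G2 = v |` B by rewrite fsetD1K.
have eAB : vert G1 `|` vert G2 = v |` (A `|` B) by rewrite eA eB -fsetUUr.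
have vA : v \notin A by rewrite !inE eqxx.
have vB : v \notin B by rewrite !inE eqxx.
rewrite eAB eA eB; apply: partsum_glue => //.
- apply/fdisjointP => x; rewrite !inE => /andP[xv x1].
  by apply/negP => /andP[_ /(inI x x1)]; apply/eqP.
(* A block without [v] avoids the only common vertex, so it has weight 0 as soon as it meets both
   sides. *)
- move=> T x y TAB xT; rewrite !inE => /andP[_ x1] yT /andP[_ y2].
  apply: (block_weight_cross _ _ xT x1 yT y2).
    by rewrite eAB (fsubset_trans TAB) // fsubsetUr.
  rewrite Iv fdisjointX1; apply/negP => /(fsubsetP TAB).
  by rewrite inE (negPf vA) (negPf vB).
(* The block of [v] induces the union of the graphs induced on [v |] T1[and]v |[T2]. These share
   exactly [v], so [b_glue] factors its weight. *)
- move=> T1 T2 T1A T2B.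
  have S1 : v |` T1 `<=` vert G1 by rewrite eA fsetUS.
  have S2 : v |` T2 `<=` vert G2 by rewrite eB fsetUS.
  have E1 : (v |` (T1 `|` T2)) `&` vert G1 = v |` T1.
    apply/fsetP => x; rewrite !inE; have [->|xv /=] := eqVneq x v; first by rewrite v1.
    have [/(fsubsetP T1A)|_ /=] := boolP (x \in T1).
      by rewrite !inE => /andP[_ ->].
    apply/negP => /andP[/(fsubsetP T2B)]; rewrite !inE xv /= => x2 x1.
    by move: xv; rewrite (inI x) ?eqxx.
  have E2 : (v |` (T1 `|` T2)) `&` vert G2 = v |` T2.
    apply/fsetP => x; rewrite !inE; have [->|xv /=] := eqVneq x v; first by rewrite v2.
    have [/(fsubsetP T2B)|_ /=] := boolP (x \in T2).
      by rewrite !inE orbT => /andP[_ ->].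
    rewrite orbF; apply/negP => /andP[/(fsubsetP T1A)]; rewrite !inE xv /= => x1 x2.
    by move: xv; rewrite (inI x) ?eqxx.
  rewrite /block_weight (induced_gunionl c1' S1) (induced_gunionr c1' S2).
  rewrite induced_gunion E1 E2 b_glue.
    by rewrite -!scalerAr -scalerAl !scalerA mulrC.
  rewrite /= (fsetIidPr S1) (fsetIidPr S2); apply/eqP/cardfs1P; exists v.
  apply/fsetP => x; rewrite !inE; case: eqVneq => //= xv.
  apply/negP => /andP[xT1 xT2]; move/eqP: xv; apply; apply: inI.
    by apply: (fsubsetP S1); rewrite fset1Ur.
  by apply: (fsubsetP S2); rewrite fset1Ur.
Qed.

End GraphPolynomials.

Theorem theorem6p5 (R : realType) (V : choiceType) (b : sgraph V -> R[i]) :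
  two_multiplicative (fpoly b) <->
  (forall H : sgraph V, vert H <> fset0 -> ~ gconnected H -> b H = 0) /\
  (forall H1 H2 : sgraph V, #|` vert H1 `&` vert H2| = 1%N ->
     b (gunion H1 H2) = b H1 * b H2).
Proof.
split=> [fM|[b0 bM]].
  split=> [H /eqP|H1 H2]; last exact: two_multiplicative_gunion.
  by case: fM => fM _; apply: multiplicative_disconnected.
by split; [apply: fpoly_multiplicative | move=> G1 G2; apply: fpoly_glue].
Qed.
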